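(* Let $(G,H,\alpha,\tau)$ be a Lie crossed module, let $\overline A$ and $A$ be connections on a principal $G$-bundle $\pi:P\to M$, let $B$ be an $L(H)$-valued $\alpha$-equivariant $2$-form on $P$ vanishing on vertical vectors, and let $\omega_{(A,B)}$ be the $1$-form given, for a continuous vector field $\tilde v$ along an $\overline A$-horizontal piecewise $C^1$ path $\tilde\gamma:[t_0,t_1]\to P$, by $$\omega_{(A,B)}(\tilde v)=A\bigl(\tilde v(t_0)\bigr)+\tau\left[\int_{t_0}^{t_1}B\bigl(\tilde\gamma'(t),\tilde v(t)\bigr)\,dt\right].$$ Then $\omega_{(A,B)}$ is well-defined as a $1$-form on tangent vectors to backtrack equivalence classes of $\overline A$-horizontal paths on $P$ in the following sense. Suppose $\gamma:[t_0,t_1]\to M$ is a piecewise $C^1$ path, and $\gamma_0$ is a path obtained by erasing a backtrack over $[T,T+\delta]$ from $\gamma$. Let $\tilde\gamma$ be an $\overline A$-horizontal lift of $\gamma$ and $\tilde\gamma_0$ the $\overline A$-horizontal lift of $\gamma_0$ with the same initial point as $\tilde\gamma$. Suppose $\tilde v$ is a continuous vector field along $\tilde\gamma$ that backtracks over $[T,T+\delta]$. Then $$\omega_{(A,B)}(\tilde v)=\omega_{(A,B)}(\tilde v_0),$$ where $\tilde v_0$ is the vector field along $\tilde\gamma_0$ induced by $\tilde v$ through restriction. In particular, $\omega_{(A,B)}(\tilde v)$ is $0$ if and only if $\omega_{(A,B)}(\tilde v_0)$ is also $0$.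
   Context: A crossed module $(G,H,\alpha,\tau)$ consists of groups $G,H$ and homomorphisms $\tau:H\to G$, $\alpha:G\to\mathrm{Aut}(H)$ with $\tau(\alpha(g)h)=g\tau(h)g^{-1}$ and $\alpha(\tau(h))(h')=hh'h^{-1}$ for all $g\in G$, $h,h'\in H$. It is a Lie crossed module if $G,H$ are Lie groups, $\tau$ is smooth, and $(g,h)\mapsto\alpha(g)h$ is smooth. $L(\cdot)$ denotes the Lie algebra; the derivatives $L(H)\to L(G)$ of $\tau$ and $L(H)\to L(H)$ of $\alpha(g)$ are again denoted $\tau$ and $\alpha(g)$. For $v\in T_pP$ and $g\in G$, $vg=dR_g|_p(v)\in T_{pg}P$, where $R_g(p)=pg$. The $2$-form $B$ is $\alpha$-equivariant if $B_{pg}(vg,wg)=\alpha(g^{-1})B_p(v,w)$ for all $g\in G$, $p\in P$, $v,w\in T_pP$; it vanishes on vertical vectors if $B(v,w)=0$ whenever $v,w\in T_pP$ and $\pi_*v=0$. A piecewise $C^1$ path $\tilde\gamma$ is $\overline A$-horizontal if $\overline A(\tilde\gamma'(t))=0$ wherever $\tilde\gamma'(t)$ exists. A vector field along $\tilde\gamma$ is a map $\tilde v$ with $\tilde v(t)\in T_{\tilde\gamma(t)}P$. A map $\gamma:[t_0,t_1]\to X$ backtracks over $[T,T+\delta]$, where $t_0\le T<T+2\delta<t_1$, if $\gamma(T+u)=\gamma(T+2\delta-u)$ for all $u\in[0,\delta]$ (for vector fields, the same condition as a map into the tangent bundle). Erasure of this backtrack is the map on $[t_0,t_1-2\delta]$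 given by $t\mapsto\gamma(t)$ for $t\in[t_0,T]$ and $t\mapsto\gamma(t+2\delta)$ for $t\in[T,t_1-2\delta]$. If $\gamma=\pi\circ\tilde\gamma$ backtracks over $[T,T+\delta]$, so does its horizontal lift $\tilde\gamma$, and $\tilde\gamma_0$ is the erasure of that backtrack from $\tilde\gamma$; $\tilde v_0$ is the vector field along $\tilde\gamma_0$ obtained by erasing the backtrack over $[T,T+\delta]$ from $\tilde v$. *)

(* Defs.v *)
From HB Require Import structures.
From mathcomp Require Import all_boot all_order all_algebra.
From mathcomp Require Import all_classical all_reals all_analysis.
Set Implicit Arguments.
Unset Strict Implicit.
Unset Printing Implicit Defensive.
Import Order.TTheory GRing.Theory Num.Theory.
Import numFieldNormedType.Exports.
Local Open Scope classical_set_scope.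
Local Open Scope ring_scope.

(* [f] is C^k on [D]; only used for [D] open and [V], [W] finite-dimensional,
   where continuity of all iterated directional derivatives up to order [k] is
   the usual notion. *)
Fixpoint Ck_on (R : realType) (V W : normedModType R) (k : nat) (D : set V)
    (f : V -> W) : Prop :=
  match k with
  | 0%N => forall x, D x -> {for x, continuous f}
  | k'.+1 => (forall x, D x -> differentiable f x) /\
             (forall v : V, Ck_on k' D ('D_v f))
  end.

Definition Cinfty_on (R : realType) (V W : normedModType R) (D : set V)
  (f : V -> W) : Prop := forall k, Ck_on k D f.

Record chart (M : topologicalType) (R : realType) (n : nat) := Chart {
  cdom : set M;
  cmap : M -> 'rV[R]_n;
  cinv : 'rV[R]_n -> M;
  cdom_open : open cdom;
  cimg_open : open (cmap @` cdom);
  cmapK : forall p, cdom p -> cinv (cmap p) = p;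
  cmap_cont : forall p, cdom p -> {for p, continuous cmap};
  cinv_cont : forall x, (cmap @` cdom) x -> {for x, continuous cinv}
}.

(* [chart_at] is a choice of an atlas chart around each point, used only to
   represent tangent vectors. *)
HB.mixin Record isManifold (R : realType) (n : nat) M of Topological M := {
  atlas : set (chart M R n);
  chart_at : M -> chart M R n;
  chart_atP : forall p, atlas (chart_at p) /\ cdom (chart_at p) p;
  transition_smooth : forall c c', atlas c -> atlas c' ->
    Cinfty_on (cmap c @` (cdom c `&` cdom c')) (cmap c' \o cinv c);
  manifold_hausdorff : hausdorff_space M;
  manifold_second_countable : @second_countable M
}.

#[short(type="manifoldType")]
HB.structure Definition Manifold (R : realType) (n : nat) :=
  { M of isManifold R n M & Topological M }.

Section SmoothMaps.
Context (R : realType) (m n l : nat).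
Context (M : manifoldType R m) (N : manifoldType R n) (Q : manifoldType R l).

(* used for [D] open *)
Definition smooth_on (D : set M) (f : M -> N) : Prop :=
  (forall p, D p -> {for p, continuous f}) /\
  (forall (c : chart M R m) (c' : chart N R n), atlas c -> atlas c' ->
    Cinfty_on (cmap c @` (cdom c `&` D `&` f @^-1` cdom c'))
      (cmap c' \o f \o cinv c)).

(* smoothness on an open [D] of the product manifold, in product charts *)
Definition smooth2_on (D : set (M * N)) (f : M -> N -> Q) : Prop :=
  (forall z, D z -> {for z, continuous (fun z : M * N => f z.1 z.2)}) /\
  (forall (c : chart M R m) (c' : chart N R n) (c'' : chart Q R l),
    atlas c -> atlas c' -> atlas c'' ->
    Cinfty_on
      ((fun z : M * N => (cmap c z.1, cmap c' z.2)) @`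
        [set z | [/\ cdom c z.1, cdom c' z.2, D z & cdom c'' (f z.1 z.2)]])
      (fun x : 'rV[R]_m * 'rV[R]_n =>
        cmap c'' (f (cinv c x.1) (cinv c' x.2)))).

End SmoothMaps.

Section Tangent.
Context (R : realType) (n : nat) (M : manifoldType R n).

(* T_pM is represented by coordinates in the chart [chart_at p]; the tangent
   bundle is then the type {p : M & Tan p}, in which equality is equality of
   tangent vectors. *)
Definition Tan (p : M) : normedModType R := 'rV[R]_n.

Definition TM : Type := {p : M & Tan p}.

(* coordinates of a tangent vector in the chart [c], and conversely *)
Definition coord (c : chart M R n) (p : M) (v : Tan p) : 'rV[R]_n :=
  'd (cmap c \o cinv (chart_at p)) (cmap (chart_at p) p) v.

Definition of_coord (c : chart M R n) (p : M) (u : 'rV[R]_n) : Tan p :=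
  'd (cmap (chart_at p) \o cinv c) (cmap c p) u.

End Tangent.

Definition dmap (R : realType) (m n : nat) (M : manifoldType R m)
    (N : manifoldType R n) (f : M -> N) (p : M) (v : Tan p) : Tan (f p) :=
  'd (cmap (chart_at (f p)) \o f \o cinv (chart_at p))
     (cmap (chart_at p) p) v.

HB.mixin Record isLieGroup (R : realType) (n : nat) G
    of Group G & Manifold R n G := {
  mul_smooth : smooth2_on setT (fun x y : G => (x * y)%g);
  inv_smooth : smooth_on setT (fun x : G => (x^-1)%g)
}.

#[short(type="lieGroupType")]
HB.structure Definition LieGroup (R : realType) (n : nat) :=
  { G of isLieGroup R n G & Group G & Manifold R n G }.

Definition Lie (R : realType) (n : nat) (G : lieGroupType R n)
  : normedModType R := Tan (1%g : G).

(* The derivative at 1 of a map f with f 1 = 1; since [Tan (f 1)] and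
   [Tan 1] are convertible, no cast is needed. *)
Definition dLie (R : realType) (m n : nat) (G : lieGroupType R m)
  (H : lieGroupType R n) (f : G -> H) (X : Lie G) : Lie H :=
  @dmap R m n G H f 1%g X.

Definition Ad (R : realType) (n : nat) (G : lieGroupType R n) (g : G)
  : Lie G -> Lie G := dLie (fun x : G => (g * x * g^-1)%g).

Record lie_crossed_module (R : realType) (nG nH : nat)
    (G : lieGroupType R nG) (H : lieGroupType R nH)
    (alpha : G -> H -> H) (tau : H -> G) : Prop := {
  tauM : {morph tau : h h' / (h * h')%g};
  alpha_morph : forall g, {morph alpha g : h h' / (h * h')%g};
  alpha_bij : forall g, bijective (alpha g);
  alphaM : forall g g' h, alpha (g * g')%g h = alpha g (alpha g' h);
  tau_alpha : forall g h, tau (alpha g h) = (g * tau h * g^-1)%g;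
  alpha_tau : forall h h', alpha (tau h) h' = (h * h' * h^-1)%g;
  tau_smooth : smooth_on setT tau;
  alpha_smooth : smooth2_on setT alpha
}.

Record principal_bundle (R : realType) (nG nP nM : nat)
    (G : lieGroupType R nG) (P : manifoldType R nP) (M : manifoldType R nM)
    (pi : P -> M) (act : P -> G -> P) : Prop := {
  pi_smooth : smooth_on setT pi;
  act_smooth : smooth2_on setT act;
  act1 : forall p, act p 1%g = p;
  actM : forall p g h, act p (g * h)%g = act (act p g) h;
  act_free : forall p g, act p g = p -> g = 1%g;
  pi_fiber : forall p q, pi p = pi q <-> exists g, q = act p g;
  (* [p |-> (pi p, phi p)] is an equivariant diffeomorphism of [pi^-1 U]
     onto [U * G], with inverse [chi] *)
  locally_trivial : forall x : M, exists (U : set M) (phi : P -> G)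
      (chi : M -> G -> P),
    [/\ open U /\ U x,
        smooth_on (pi @^-1` U) phi,
        smooth2_on (U `*` setT) chi,
        (forall p g, U (pi p) -> phi (act p g) = (phi p * g)%g) &
        (forall p, U (pi p) -> chi (pi p) (phi p) = p) /\
        (forall y g, U y -> pi (chi y g) = y /\ phi (chi y g) = g)]
}.

Section Forms.
Context (R : realType) (n : nat) (P : manifoldType R n) (V : normedModType R).

Record smooth_one_form (A : forall p : P, Tan p -> V) : Prop := {
  one_form_linear : forall p, linear (A p);
  one_form_smooth : forall c : chart P R n, atlas c -> forall u,
    Cinfty_on (cmap c @` cdom c)
      (fun x => A (cinv c x) (of_coord c (cinv c x) u))
}.

Record smooth_two_form (B : forall p : P, Tan p -> Tan p -> V) : Prop := {
  two_form_linearl : forall p w, linear (B p ^~ w);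
  two_form_linearr : forall p v, linear (B p v);
  two_form_alternating : forall p v, B p v v = 0;
  two_form_smooth : forall c : chart P R n, atlas c -> forall u w,
    Cinfty_on (cmap c @` cdom c)
      (fun x => B (cinv c x) (of_coord c (cinv c x) u)
                             (of_coord c (cinv c x) w))
}.

End Forms.

Section Bundle.
Context (R : realType) (nG nH nP nM : nat).
Context (G : lieGroupType R nG) (H : lieGroupType R nH).
Context (P : manifoldType R nP) (M : manifoldType R nM).
Context (pi : P -> M) (act : P -> G -> P).

(* v |-> vg *)
Definition tact (p : P) (v : Tan p) (g : G) : Tan (act p g) :=
  @dmap R nP nP P P (act^~ g) p v.

(* the value at [p] of the vector field on P generated by [X]; it lies in
   [Tan (act p 1)], i.e. in [Tan p] *)
Definition fundamental (p : P) (X : Lie G) : Tan p :=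
  @dmap R nG nP G P (act p) 1%g X.

Record connection (A : forall p : P, Tan p -> Lie G) : Prop := {
  connection_form : smooth_one_form A;
  connection_equivariant : forall p g (v : Tan p),
    A (act p g) (tact v g) = Ad g^-1%g (A p v);
  connection_vertical : forall p X, A p (fundamental p X) = X
}.

Definition alpha_equivariant (alpha : G -> H -> H)
    (B : forall p : P, Tan p -> Tan p -> Lie H) : Prop :=
  forall p g (v w : Tan p),
    B (act p g) (tact v g) (tact w g) = dLie (alpha g^-1%g) (B p v w).

Definition vanishes_on_vertical
    (B : forall p : P, Tan p -> Tan p -> Lie H) : Prop :=
  forall p (v w : Tan p), dmap pi v = 0 -> B p v w = 0.

End Bundle.

(* A path on [t0, t1] is a map from R of which only the values on [t0, t1]
   matter. *)

Section Paths.
Context (R : realType) (n : nat) (X : manifoldType R n).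

(* C^1 on the closed interval [a, b], i.e. extendable to a C^1 map on an open
   interval *)
Definition C1_path (a b : R) (f : R -> X) : Prop :=
  exists (e : R) (s : R -> X),
    [/\ 0 < e,
        forall t, t \in `[a, b] -> s t = f t,
        forall t, t \in `]a - e, b + e[ -> {for t, continuous s} &
        forall c : chart X R n, atlas c ->
          Ck_on 1 [set t : R | (t \in `]a - e, b + e[) /\ cdom c (s t)]
            (cmap c \o s)].

Definition piecewise_C1 (t0 t1 : R) (f : R -> X) : Prop :=
  exists ts : seq R,
    [/\ path <%R t0 ts, last t0 ts = t1 &
        forall i, (i < size ts)%N ->
          C1_path (nth t0 (t0 :: ts) i) (nth t0 ts i) f].

Definition has_velocity (f : R -> X) (t : R) : Prop :=
  {for t, continuous f} /\ derivable (cmap (chart_at (f t)) \o f) t 1.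

Definition velocity (f : R -> X) (t : R) : Tan (f t) :=
  derive1 (cmap (chart_at (f t)) \o f) t.

(* continuity on [t0, t1] of the map t |-> v t into the tangent bundle, along
   a continuous [f], in the bundle charts *)
Definition continuous_field (t0 t1 : R) (f : R -> X)
    (v : forall t, Tan (f t)) : Prop :=
  {within `[t0, t1], continuous f} /\
  (forall c : chart X R n, atlas c ->
    {within [set t : R | t \in `[t0, t1] /\ cdom c (f t)],
      continuous (fun t => coord c (v t))}).

End Paths.

Definition bundle_path (R : realType) (n : nat) (X : manifoldType R n)
    (f : R -> X) (v : forall t, Tan (f t)) : R -> TM X :=
  fun t => existT (fun p : X => Tan p : Type) (f t) (v t).

Definition backtracks (R : realType) (X : Type) (T d : R) (f : R -> X) : Prop :=
  forall u, 0 <= u <= d -> f (T + u) = f (T + 2 * d - u).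

Definition erase (R : realType) (X : Type) (T d : R) (f : R -> X) : R -> X :=
  fun t => if t <= T then f t else f (t + 2 * d).

Definition vintegral (R : realType) (n : nat) (t0 t1 : R)
    (f : R -> 'rV[R]_n) : 'rV[R]_n :=
  \row_i (\int[lebesgue_measure]_(t in `[t0, t1]) (f t 0 i)).

Section Omega.
Context (R : realType) (nG nH nP nM : nat).
Context (G : lieGroupType R nG) (H : lieGroupType R nH).
Context (P : manifoldType R nP) (M : manifoldType R nM).

Definition horizontal (A : forall p : P, Tan p -> Lie G) (t0 t1 : R)
    (f : R -> P) : Prop :=
  piecewise_C1 t0 t1 f /\
  (forall t, t \in `]t0, t1[ -> has_velocity f t ->
    A (f t) (velocity f t) = 0).

Definition horizontal_lift (pi : P -> M) (A : forall p : P, Tan p -> Lie G)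
    (t0 t1 : R) (f : R -> M) (ft : R -> P) : Prop :=
  horizontal A t0 t1 ft /\ (forall t, t \in `[t0, t1] -> pi (ft t) = f t).

Definition omega (tau : H -> G) (A : forall p : P, Tan p -> Lie G)
    (B : forall p : P, Tan p -> Tan p -> Lie H) (t0 t1 : R) (f : R -> P)
    (v : forall t, Tan (f t)) : Lie G :=
  A (f t0) (v t0) +
  dLie tau (vintegral t0 t1 (fun t => B (f t) (velocity f t) (v t))).

End Omega.

(* Main.v *)
Require Import Defs.
From HB Require Import structures.
From mathcomp Require Import all_boot all_order all_algebra lra.
From mathcomp Require Import all_classical all_reals all_analysis measurable_realfun.
Set Implicit Arguments.
Unset Strict Implicit.
Unset Printing Implicit Defensive.
Import Order.TTheory GRing.Theory Num.Theory.
Import numFieldNormedType.Exports.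
Local Open Scope classical_set_scope.
Local Open Scope ring_scope.

(* Over the backtracked interval [T, T + 2 delta] the path is symmetric about
   T + delta, so its velocity is odd and the integrand B(velocity, v) is odd as
   well: its integral over that interval vanishes. Outside it, the integrand of
   the erased path is that of the original one, up to a translation by 2 delta.
   Splitting the integrals requires integrability, which holds because the
   integrand agrees on each C^1 piece, away from the end points, with a function
   continuous on the closed piece. That
   the two lifts agree outside the backtrack is read off from the base points of
   the equality [v0 = erase v] in the tangent bundle. *)

(** * Derivatives under reflection and translation of the parameter *)

Lemma dnbhs0N (R : numFieldType) : (- x : R) @[x --> (0 : R)^'] = 0^'.
Proof.
rewrite -[in RHS]oppr0 /dnbhs withinN.
have -> // : [set - x | x in [set y : R | y != - 0]] = [set y : R | y != 0].
apply/seteqP; split => [x /= [y y0 <-]|x /= x0].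
  by move: y0; rewrite oppr0 oppr_eq0.
by exists (- x); rewrite ?opprK// oppr0 oppr_eq0.
Qed.

(* No convergence is assumed: a divergent [lim] is [point], which is 0 here. *)
Lemma limN_total (R : realType) (m n : nat) (T : Type) (F : set_system T)
    (f : T -> 'M[R]_(m, n)) : ProperFilter F ->
  lim ((- f) x @[x --> F]) = - lim (f x @[x --> F]).
Proof.
move=> FF; have [/limN//|dvgf] := pselect (cvg (f x @[x --> F])).
rewrite (dvgP dvgf) dvgP; last by rewrite is_cvgNE.
by apply/matrixP => i j; rewrite !mxE; exact: esym (@oppr0 R).
Qed.

(** The difference quotient of the reflected map at [h] is minus that of [f] at [- h], and the
    punctured neighbourhoods of 0 are symmetric. By [limN_total] this also covers points where the
    limits do not exist. *)
Lemma derive1_reflect (R : realType) (n : nat) (f : R -> 'rV[R]_n) (c t : R) :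
  derive1 (fun s => f (c - s)) t = - derive1 f (c - t).
Proof.
rewrite /derive1 -limN_total -[in RHS]dnbhs0N -fmap_comp.
set q := (fun h => _); set r := (X in _ = lim (fmap X _)).
suff -> : q = r by [].
apply/funext => h; rewrite /q -[RHS]/(- ((- h)^-1 *: (f (- h + (c - t)) - _))).
by rewrite invrN scaleNr opprK opprD addrCA.
Qed.

Lemma derive1_shift (R : realType) (n : nat) (f : R -> 'rV[R]_n) (c t : R) :
  derive1 (fun s => f (s + c)) t = derive1 f (t + c).
Proof. by rewrite /derive1; under eq_fun do rewrite -addrA. Qed.

Lemma near_eq_derive1 (R : realType) (V : normedModType R) (f g : R -> V)
    (t : R) : (\near t, f t = g t) -> derive1 f t = derive1 g t.
Proof. by rewrite !derive1E; exact: near_eq_derive. Qed.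

(** * Lebesgue integrals over intervals: reflection, translation, concatenation *)

Section Integrals.
Context (R : realType).
Notation mu := (@lebesgue_measure R).
Implicit Types (f g : R -> R) (a b c : R).

Let reflect c : measurableTypeR R -> measurableTypeR R := fun x => c - x.

Let measurable_reflect c : measurable_fun [set: measurableTypeR R] (reflect c).
Proof.
have : measurable_fun [set: R] (fun x : R => c - x).
  by exact: measurable_funB.
by [].
Qed.

(** Reflection exchanges the two ends, and a bound just before a point becomes one just after its
    image; hence the negations. *)
Let reflect_itv c (b1 b2 : bool) a b :
  reflect c @^-1` [set` Interval (BSide b1 a) (BSide b2 b)] =
  [set` Interval (BSide (~~ b2) (c - b)) (BSide (~~ b1) (c - a))].
Proof.
apply/seteqP; split => x /=; rewrite !in_itv /= /reflect;
  case: b1; case: b2 => /=; lra.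
Qed.

(** By uniqueness of Lebesgue measure it suffices to look at the intervals ]a, b], whose preimages
    [c - b, c - a[ have the same length. *)
Let reflect_measure c (A : set R) : measurable A ->
  pushforward mu (reflect c) A = mu A.
Proof.
move=> mA.
apply/esym/lebesgue_measure_unique => //=.

move=> _ [[a b]] _ <-.
rewrite /pushforward reflect_itv /= !lebesgue_measure_itv /= !lte_fin.
by rewrite ltrD2l ltrN2 -!EFinB; case: ifP => // _; congr EFin; lra.
Qed.

Let integrable_reflectT c f : mu.-integrable setT (EFin \o f) ->
  mu.-integrable setT (EFin \o (fun x => f (c - x))).
Proof.
move=> /integrableP[mf foo]; apply/integrableP; split.
  exact: measurableT_comp mf (measurable_reflect c).
apply: le_lt_trans foo.
(* The larger side is read against the image measure, equal to [mu], so that the change of variables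
   formula applies. *)
rewrite -[leRHS](@eq_measure_integral _ _ _ setT _ (pushforward mu (reflect c))).
- rewrite (ge0_integral_pushforward (measurable_reflect c))//.
  exact: measurableT_comp.
- by move=> A mA _; exact: reflect_measure.
Qed.

Let Rintegral_reflectT c f : mu.-integrable setT (EFin \o f) ->
  \int[mu]_x f (c - x) = \int[mu]_x f x.
Proof.
move=> intf; rewrite /Rintegral; congr fine.
rewrite -[RHS](@eq_measure_integral _ _ _ setT _ (pushforward mu (reflect c))).
- rewrite (integral_pushforward (measurable_reflect c))//.
    exact: measurable_int intf.
  by rewrite preimage_setT; exact: integrable_reflectT.
- by move=> A mA _; exact: reflect_measure.
Qed.

(** Reduces reflection on an interval to reflection on the whole line. *)
Let restrict_reflect c f a b :
  (fun x => f (c - x)) \_ `[c - b, c - a] =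
  (fun x => (f \_ `[a, b]) (c - x)).
Proof.
apply/funext => x; rewrite !patchE !mem_setE !in_itv /=.
suff -> : (c - b <= x <= c - a) = (a <= c - x <= b) by [].
by apply/idP/idP; lra.
Qed.

Lemma integrable_reflect c f a b : mu.-integrable `[a, b] (EFin \o f) ->
  mu.-integrable `[c - b, c - a] (EFin \o (fun x => f (c - x))).
Proof.
move=> /integrable_mkcond; rewrite restrict_EFin => /(_ (measurable_itv _)) intf.
apply/integrable_mkcond => //.
by rewrite restrict_EFin restrict_reflect; exact: integrable_reflectT.
Qed.

Lemma Rintegral_reflect c f a b : mu.-integrable `[a, b] (EFin \o f) ->
  \int[mu]_(x in `[c - b, c - a]) f (c - x) = \int[mu]_(x in `[a, b]) f x.
Proof.
move=> /integrable_mkcond; rewrite restrict_EFin => /(_ (measurable_itv _)) intf.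
by rewrite Rintegral_mkcond restrict_reflect Rintegral_reflectT// -Rintegral_mkcond.
Qed.

(** The end points form a null set. Leaving them free matters because the velocity at a break point
    need not be that of the piece under consideration. *)
Lemma eq_integrable_oo f g a b : {in `]a, b[, f =1 g} ->
  mu.-integrable `[a, b] (EFin \o f) -> mu.-integrable `[a, b] (EFin \o g).
Proof.
move=> fg intf; have intg : mu.-integrable `]a, b[ (EFin \o g).
  apply: (eq_integrable (mu := mu) (measurable_itv _) (EFin \o f)).
    by move=> x; rewrite mem_setE => /fg /= ->.
  by apply: integrableS intf => //; exact: subset_itv_oo_cc.
have mg : measurable_fun `[a, b] g.
  apply/measurable_fun_itv_bndo_bndcP/measurable_fun_itv_obnd_cbndP.
  by apply/measurable_EFinP; exact: (measurable_int mu).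
have /integrableP[_ foo] := intg; apply/integrableP; split.
  exact/measurable_EFinP.
rewrite (integral_itv_bndoo (x := a) (y := b))//.
by apply/measurable_EFinP/measurableT_comp => //; apply: measurable_funS mg => //;
  exact: subset_itv_oo_cc.
Qed.

Lemma eq_Rintegral_oo f g a b : {in `]a, b[, f =1 g} ->
  mu.-integrable `[a, b] (EFin \o f) ->
  \int[mu]_(x in `[a, b]) f x = \int[mu]_(x in `[a, b]) g x.
Proof.
move=> fg intf; have intg := eq_integrable_oo fg intf.
have mf h : mu.-integrable `[a, b] (EFin \o h) ->
    measurable_fun `]a, b[ (EFin \o h).
  move=> /(measurable_int mu) mh; apply: measurable_funS mh => //.
  exact: subset_itv_oo_cc.
rewrite /Rintegral; congr fine.
rewrite [LHS]integral_itv_bndoo; last exact: mf intf.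
rewrite [RHS]integral_itv_bndoo; last exact: mf intg.
by apply: eq_integral => x; rewrite mem_setE => /fg ->.
Qed.

Lemma integrable_itv_cat f a b c : a <= b -> b <= c ->
  mu.-integrable `[a, b] (EFin \o f) -> mu.-integrable `[b, c] (EFin \o f) ->
  mu.-integrable `[a, c] (EFin \o f).
Proof.
move=> ab bc fab fbc.
(* The left interval is made half-open so that the union is disjoint. *)
have /integrableP[m1 foo1] : mu.-integrable `[a, b[ (EFin \o f).
  by apply: integrableS fab => //; exact: subset_itv_co_cc.
have /integrableP[m2 foo2] := fbc.
have -> : `[a, c]%classic = `[a, b[ `|` `[b, c].
  by rewrite -itv_bndbnd_setU ?bnd_simp.
have mU : measurable_fun (`[a, b[ `|` `[b, c]) (EFin \o f).
  by apply/measurable_funU.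
apply/integrableP; split => //; rewrite ge0_integral_setU//.
- by rewrite lte_add_pinfty.
- exact: measurableT_comp.
- apply/disj_setPS => y [/=]; rewrite 2!in_itv/= => /andP[_ yb] /andP[].
  by rewrite leNgt yb.
Qed.

Lemma Rintegral_itv_cat f a b c : a <= b -> b <= c ->
  mu.-integrable `[a, c] (EFin \o f) ->
  \int[mu]_(x in `[a, c]) f x =
  \int[mu]_(x in `[a, b]) f x + \int[mu]_(x in `[b, c]) f x.
Proof.
move=> ab bc intf.
rewrite -(Rintegral_itv_obnd_cbnd (r := b)).
  by rewrite -(@Rintegral_itvB _ _ (BLeft a) (BRight c))// addrC subrK.
by apply: integrableS intf => //; apply: subset_itvr; rewrite bnd_simp.
Qed.

(** The reflection x |-> a + b - x preserves the interval and the integral, but changes the sign of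
    [f]: the integral is its own opposite. *)
Lemma Rintegral_antisym f a b : mu.-integrable `[a, b] (EFin \o f) ->
  {in `]a, b[, forall x, f (a + b - x) = - f x} ->
  \int[mu]_(x in `[a, b]) f x = 0.
Proof.
move=> intf fN; set I := Rintegral _ _ _; suff : I = - I by lra.
have := Rintegral_reflect (a + b) intf.
rewrite (_ : a + b - b = a); last by lra.
rewrite (_ : a + b - a = b); last by lra.
rewrite -/I => {1}<-; rewrite -(@mulN1r _ I) -RintegralZl//.
apply: eq_Rintegral_oo.
  by move=> x xab; rewrite fN// mulN1r.
have := integrable_reflect (a + b) intf.
rewrite (_ : a + b - b = a); last by lra.
by rewrite (_ : a + b - a = b); last by lra.
Qed.

(* A translation is the composite of two reflections. *)
Let shift_reflect c f : (fun x => f (x + c)) = (fun x => f (0 - (- c - x))).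
Proof. by apply/funext => x; congr f; lra. Qed.

Lemma integrable_shift c f a b : mu.-integrable `[a, b] (EFin \o f) ->
  mu.-integrable `[a - c, b - c] (EFin \o (fun x => f (x + c))).
Proof.
move=> /(integrable_reflect 0)/(integrable_reflect (- c)).
rewrite (shift_reflect c f) (_ : - c - (0 - a) = a - c); last by lra.
by rewrite (_ : - c - (0 - b) = b - c); last by lra.
Qed.

Lemma Rintegral_shift c f a b : mu.-integrable `[a, b] (EFin \o f) ->
  \int[mu]_(x in `[a - c, b - c]) f (x + c) = \int[mu]_(x in `[a, b]) f x.
Proof.
move=> intf; rewrite -[RHS](Rintegral_reflect 0)//.
rewrite -[RHS](Rintegral_reflect (- c)); last exact: integrable_reflect.
rewrite (shift_reflect c f) (_ : - c - (0 - a) = a - c); last by lra.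
by rewrite (_ : - c - (0 - b) = b - c); last by lra.
Qed.

End Integrals.

(** * Tangent vectors and velocities in a fixed chart *)

Section Charts.
Context (R : realType) (n : nat) (X : manifoldType R n).
Implicit Types (c k : chart X R n) (p : X) (s : R -> X) (t : R).

(** The overlap of two charts is open in coordinates, so identities valid only there can be
    differentiated. *)
Lemma cinv_cmap_near k c p : cdom k p -> cdom c p ->
  \forall x \near cmap k p, cdom c (cinv k x) /\ cmap k (cinv k x) = x.
Proof.
move=> kp cp.
have kx : (cmap k @` cdom k) (cmap k p) by exists p.
have kN : \forall x \near cmap k p, (cmap k @` cdom k) x.
  by apply: open_nbhs_nbhs; split => //; exact: cimg_open.
have cN : \forall x \near cmap k p, cdom c (cinv k x).
  apply: (cinv_cont kx); rewrite cmapK//.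
  by apply: open_nbhs_nbhs; split => //; exact: cdom_open.
by apply: filterS2 kN cN => x [q kq <-] cq; split => //; rewrite cmapK.
Qed.

Lemma transition_differentiable c c' p : atlas c -> atlas c' ->
  cdom c p -> cdom c' p -> differentiable (cmap c' \o cinv c) (cmap c p).
Proof.
move=> ac ac' cp c'p; have [dT _] := transition_smooth _ _ ac ac' 1.
by apply: dT; exists p.
Qed.

Lemma near_eq_diff (V W : normedModType R) (f g : V -> W) (x : V) :
  differentiable f x -> differentiable g x -> (\near x, f x = g x) ->
  'd f x =1 'd g x.
Proof. by move=> df dg fg v; rewrite -!deriveE//; exact: near_eq_derive. Qed.

(** Chain rule for two mutually inverse transition maps; their composite is known to be the identity
    only near the point, which is enough for the differential. *)
Lemma diff_transitionK c k p (u : 'rV[R]_n) : atlas c -> atlas k ->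
  cdom c p -> cdom k p ->
  'd (cmap k \o cinv c) (cmap c p) ('d (cmap c \o cinv k) (cmap k p) u) = u.
Proof.
move=> ac ak cp kp.
have dck := transition_differentiable ak ac kp cp.
have dkc := transition_differentiable ac ak cp kp.
(* [diff_comp] takes the outer differential at the image of the inner base point. *)
have eqp : cmap c p = (cmap c \o cinv k) (cmap k p) by rewrite /= cmapK.
rewrite eqp in dkc *; rewrite -[LHS]/(('d _ _ \o 'd _ _) _) -diff_comp//.
rewrite (@near_eq_diff _ _ _ id).
- by rewrite (diff_val (f := id) (df := id)).
- exact: differentiable_comp.
- exact: (ex_diff (f := id) (df := id)).
by apply: filterS (cinv_cmap_near kp cp) => x [cx kx] /=; rewrite cmapK.
Qed.

Lemma of_coordK c p (u : Tan p) : atlas c -> cdom c p ->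
  of_coord c p (Defs.coord c u) = u.
Proof.
by move=> ac cp; have [ak kp] := chart_atP p; exact: diff_transitionK.
Qed.

(** [velocity] is computed in [chart_at (s t)], a chart that may jump with [t]. The chain rule moves
    it to a fixed chart, where continuity in [t] can be tested. *)
Lemma coord_velocity c s t : atlas c -> cdom c (s t) -> {for t, continuous s} ->
  derivable (cmap (chart_at (s t)) \o s) t 1 ->
  Defs.coord c (velocity s t) = derive1 (cmap c \o s) t.
Proof.
move=> ac cst cs ds; have [ak kst] := chart_atP (s t).
have dck := transition_differentiable ak ac kst cst.
rewrite /Defs.coord /velocity; set k := chart_at (s t) in ds ak kst dck *.
have /derivable1_diffP ds' := ds.
have e : 'd ((cmap c \o cinv k) \o (cmap k \o s)) t 1 =
    'd (cmap c \o cinv k) (cmap k (s t)) ('d (cmap k \o s) t 1).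
  by have /(congr1 (@^~ 1)) := diff_comp ds' dck.
rewrite (derive1E' ds') -e.
rewrite -derive1E'; last exact: differentiable_comp.
(* By continuity [s] stays in the domain of [k] near [t], where [cinv k] undoes [cmap k]. *)
apply: near_eq_derive1.
have : \forall u \near t, cdom k (s u).
  by apply: cs; apply: open_nbhs_nbhs; split => //; exact: cdom_open.
by apply: filterS => u ku /=; rewrite cmapK.
Qed.

End Charts.

(** * Continuity of a 2-form along moving base points *)

Lemma cvg_mxcoord (R : realType) (m n : nat) (T : Type) (F : set_system T)
    (f : T -> 'M[R]_(m, n)) (l : 'M[R]_(m, n)) i j :
  Filter F -> f @ F --> l -> f t i j @[t --> F] --> l i j.
Proof.
move=> FF fl.
by apply: (@continuous_cvg _ _ _ _ _ _ (fun M : 'M[R]_(m, n) => M i j) _ _ fl);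
  exact: coord_continuous.
Qed.

Section TwoForms.
Context (R : realType) (n : nat) (X : manifoldType R n) (V : normedModType R).
Context (B : forall p : X, Tan p -> Tan p -> V).
Hypothesis hB : smooth_two_form B.

Lemma two_form_sum p (v w : 'I_n -> Tan p) (a b : 'I_n -> R) :
  @B p (\sum_i a i *: v i) (\sum_j b j *: w j) =
  \sum_i \sum_j (a i * b j) *: @B p (v i) (w j).
Proof.
have linl w' : @B p (\sum_i a i *: v i) w' = \sum_i a i *: @B p (v i) w'.
  pose L : {linear 'rV[R]_n -> V} :=
    HB.pack (@B p ^~ w') (GRing.isLinear.Build _ _ _ _ _ (two_form_linearl hB w')).
  by rewrite -[LHS]/(L _) linear_sum; apply: eq_bigr => i _; rewrite linearZ.
have linr v' : @B p v' (\sum_i b i *: w i) = \sum_i b i *: @B p v' (w i).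
  pose L : {linear 'rV[R]_n -> V} :=
    HB.pack (@B p v') (GRing.isLinear.Build _ _ _ _ _ (two_form_linearr hB v')).
  by rewrite -[LHS]/(L _) linear_sum; apply: eq_bigr => i _; rewrite linearZ.
rewrite linl; apply: eq_bigr => i _; rewrite linr scaler_sumr.
by apply: eq_bigr => j _; rewrite scalerA.
Qed.

Lemma of_coord_sum (c : chart X R n) p (u : 'rV[R]_n) :
  of_coord c p u = \sum_i u 0 i *: of_coord c p (delta_mx 0 i).
Proof.
rewrite /of_coord [in LHS](row_sum_delta u) linear_sum.
by apply: eq_bigr => i _; rewrite linearZ.
Qed.

(** Bilinear expansion in the coordinate frame of [c]; its coefficients are the functions that
    [two_form_smooth] controls. *)
Lemma two_form_coord c p (v w : Tan p) : atlas c -> cdom c p ->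
  @B p v w = \sum_i \sum_j (Defs.coord c v 0 i * Defs.coord c w 0 j) *:
    @B p (of_coord c p (delta_mx 0 i)) (of_coord c p (delta_mx 0 j)).
Proof.
move=> ac cp; rewrite -[in LHS](of_coordK v ac cp) -[in LHS](of_coordK w ac cp).
by rewrite of_coord_sum [in X in @B _ _ X]of_coord_sum two_form_sum.
Qed.

(** The fibres vary with [t], so everything is expressed in one chart around the limit point, where
    the value is a finite sum of products of convergent factors. *)
Lemma two_form_cvg (T : Type) (F : set_system T) (g : T -> X) (q : X)
    (v w : forall t, Tan (g t)) (v0 w0 : Tan q) c :
  Filter F -> atlas c -> cdom c q -> g @ F --> q ->
  Defs.coord c (v t) @[t --> F] --> Defs.coord c v0 ->
  Defs.coord c (w t) @[t --> F] --> Defs.coord c w0 ->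
  @B (g t) (v t) (w t) @[t --> F] --> @B q v0 w0.
Proof.
move=> FF ac cq gq vv0 ww0.
have cg : \forall t \near F, cdom c (g t).
  by apply: gq; apply: open_nbhs_nbhs; split => //; exact: cdom_open.
pose b i j p := @B p (of_coord c p (delta_mx 0 i)) (of_coord c p (delta_mx 0 j)).
have bcvg i j : b i j (g t) @[t --> F] --> b i j q.
  have cgq : cmap c (g t) @[t --> F] --> cmap c q.
    by apply: (cvg_comp _ _ gq); exact: cmap_cont.
  have bc : b i j (cinv c (cmap c (g t))) @[t --> F] -->
      b i j (cinv c (cmap c q)).
    (* Smoothness speaks of the coefficient composed with [cinv c]; level 0 of [Cinfty_on] is
       continuity on the chart image. *)
    apply: (@continuous_cvg _ _ _ _ _ _ (b i j \o cinv c) _ _ cgq).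
    by apply: (two_form_smooth hB ac _ _ 0); exists q.
  rewrite (cmapK cq) in bc; apply: cvg_trans bc; apply: near_eq_cvg.
  by apply: filterS cg => t ct; rewrite (cmapK ct).
rewrite (two_form_coord _ _ ac cq).
have : (\sum_i \sum_j (Defs.coord c (v t) 0 i * Defs.coord c (w t) 0 j) *:
     b i j (g t)) @[t --> F] -->
   \sum_i \sum_j (Defs.coord c v0 0 i * Defs.coord c w0 0 j) *: b i j q.
  apply: cvg_big => [|i _]; first exact: add_continuous.
  apply: cvg_big => [|j _]; first exact: add_continuous.
  apply: cvgZ => //.
  by apply: cvgM; exact: cvg_mxcoord.
apply: cvg_trans; apply: near_eq_cvg.
by apply: filterS cg => t ct; rewrite (two_form_coord _ _ ac ct).
Qed.

End TwoForms.

(** * Velocities of paths and equality in the tangent bundle *)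

Lemma near_eq_continuous_at (T U : topologicalType) (f g : T -> U) (t : T) :
  (\near t, f t = g t) -> {for t, continuous g} -> {for t, continuous f}.
Proof.
move=> fg gt W /=; rewrite (nbhs_singleton fg : f t = g t) => /gt.
by apply: filterS2 fg => u fgu; rewrite /preimage /= fgu.
Qed.

Section Velocity.
Context (R : realType) (n : nat) (X : manifoldType R n).
Implicit Types (f g : R -> X) (c t : R).

(** The equation lives in ['rV[R]_n], to which both tangent spaces unfold, because [f t] and [g t]
    are equal only propositionally. *)
Lemma near_eq_velocity f g t : (\near t, f t = g t) ->
  velocity f t = velocity g t :> 'rV[R]_n.
Proof.
move=> fg; rewrite /velocity (nbhs_singleton fg); apply: near_eq_derive1.
by apply: filterS fg => u /= ->.
Qed.

Lemma velocity_reflect g c t :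
  velocity (fun s => g (c - s)) t = - velocity g (c - t) :> 'rV[R]_n.
Proof. exact: (derive1_reflect (cmap (chart_at (g (c - t))) \o g)). Qed.

Lemma velocity_shift g c t :
  velocity (fun s => g (s + c)) t = velocity g (t + c) :> 'rV[R]_n.
Proof. exact: (derive1_shift (cmap (chart_at (g (t + c))) \o g)). Qed.

(** All fibres unfold to ['rV[R]_n], so the second projection is a non-dependent function and no
    transport along [f s = g t] appears. *)
Lemma bundle_path_inj f g (v : forall t, Tan (f t)) (w : forall t, Tan (g t))
    (s t : R) : bundle_path v s = bundle_path w t ->
  f s = g t /\ v s = w t :> 'rV[R]_n.
Proof.
move=> vw; split; first exact: (congr1 (@projT1 _ _) vw).
exact: (congr1 (fun z : TM X => projT2 z : 'rV[R]_n) vw).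
Qed.

End Velocity.

(** * The integrand of the 2-form along a path, and erasure of a backtrack *)

Section PathIntegrand.
Context (R : realType) (n m : nat) (X : manifoldType R n).
Context (B : forall p : X, Tan p -> Tan p -> 'rV[R]_m).
Hypothesis hB : smooth_two_form B.
Notation mu := (@lebesgue_measure R).

Lemma two_formNl p (v w : Tan p) : @B p (- v) w = - @B p v w.
Proof.
pose L : {linear 'rV[R]_n -> 'rV[R]_m} :=
  HB.pack (@B p ^~ w) (GRing.isLinear.Build _ _ _ _ _ (two_form_linearl hB w)).
by rewrite -[LHS]/(L _) linearN.
Qed.

(** With the vectors typed as rows, the base point can be substituted without transporting them. *)
Lemma eq_two_form p q (v w v' w' : 'rV[R]_n) : p = q -> v = v' -> w = w' ->
  @B p v w = @B q v' w'.
Proof. by move=> -> -> ->. Qed.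

Lemma C1_path_integrand_integrable (t0 t1 a b : R) (g : R -> X)
    (v : forall t, Tan (g t)) i :
  C1_path a b g -> t0 <= a -> b <= t1 -> continuous_field t0 t1 v ->
  mu.-integrable `[a, b] (EFin \o (fun t => @B (g t) (velocity g t) (v t) 0 i)).
Proof.
move=> [e [s [e0 sg cs C1s]]] t0a bt1 [cg cv].
(* [F] takes base point and velocity from the C^1 extension [s], which is regular at [a] and [b]
   too, but keeps the field [v] along [g]. *)
pose F t : 'rV[R]_m := @B (s t) (velocity s t) (v t).
have inI t : t \in `[a, b] -> t \in `]a - e, b + e[.
  by rewrite !in_itv /=; lra.
have C1c c t : atlas c -> t \in `]a - e, b + e[ -> cdom c (s t) ->
    derivable (cmap c \o s) t 1 /\ {for t, continuous (derive1 (cmap c \o s))}.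
  move=> ac tI ct; have [ds Ds] := C1s c ac; split.
    by apply/derivable1_diffP; apply: ds.
  rewrite (_ : derive1 _ = 'D_1 (cmap c \o s)); first exact: Ds.
  by apply/funext => u; rewrite derive1E.
have cF : {within `[a, b], continuous F}.
  apply/subspace_continuousP => t tab.
  have [ac ct] := chart_atP (s t); set c := chart_at (s t) in ac ct.
  have tI := inI t tab.
  have st := cs t tI.
  apply: (two_form_cvg hB (c := c)) => //.
  - by apply: cvg_within_filter; exact: st.
  (* Near [t] the coordinates in [c] of the velocity of [s] are the derivative of [cmap c \o s],
     which is continuous. *)
  - have [_ cD] := C1c _ _ ac tI ct.
    apply: cvg_within_filter; apply: (near_eq_continuous_at _ cD).
    have Ic : \forall u \near t, u \in `]a - e, b + e[.
      exact: near_in_itvoo.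
    have dc : \forall u \near t, cdom c (s u).
      by apply: st; apply: open_nbhs_nbhs; split => //; exact: cdom_open.
    apply: filterS2 Ic dc => u uI uc.
    have [ak ku] := chart_atP (s u).
    exact: (coord_velocity ac uc (cs u uI) (C1c _ _ ak uI ku).1).
  - have gt : g t = s t by rewrite sg.
    have abI u : u \in `[a, b] -> u \in `[t0, t1].
      by rewrite !in_itv /=; lra.
    have tS : t \in `[t0, t1] /\ cdom c (g t) by rewrite gt; split => //; exact: abI.
    have /subspace_continuousP/(_ t tS) cvt := cv c ac.
    (* [K] separates base point and vector, so that [s u] can be replaced by [g u] under [coord]. *)
    pose K p (u : 'rV[R]_n) := @Defs.coord R n X c p u.
    have sgK u : u \in `[a, b] -> K (s u) (v u) = K (g u) (v u).
      by move=> uab; rewrite sg.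
    have dc : \forall u \near t, cdom c (s u).
      by apply: st; apply: open_nbhs_nbhs; split => //; exact: cdom_open.
    move=> W; rewrite -[X in nbhs X W]/(K (s t) (v t)) sgK// => /cvt.
    apply: filterS2 dc => u uc Wu uab.
    rewrite /preimage /= -[X in W X]/(K (s u) (v u)) sgK//; apply: Wu.
    by split; [exact: abI|rewrite -sg].
apply: (@eq_integrable_oo _ (fun t => F t 0 i)).
  move=> t tab.
  have st : s t = g t by rewrite sg//; apply: subset_itv_oo_cc.
  have vst : velocity s t = velocity g t :> 'rV[R]_n.
    apply: near_eq_velocity; have : \forall u \near t, u \in `]a, b[.
      exact: near_in_itvoo.
    by apply: filterS => u uab; rewrite sg//; apply: subset_itv_oo_cc.
  exact: (congr1 (fun M : 'rV[R]_m => M 0 i) (eq_two_form st vst erefl)).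
apply: continuous_compact_integrable; first exact: segment_compact.
apply/subspace_continuousP => t tab; apply: cvg_mxcoord.
by move/subspace_continuousP : cF; apply.
Qed.

Lemma piecewise_C1_integrand_integrable (t0 t1 : R) (g : R -> X)
    (v : forall t, Tan (g t)) i :
  piecewise_C1 t0 t1 g -> continuous_field t0 t1 v ->
  mu.-integrable `[t0, t1]
    (EFin \o (fun t => @B (g t) (velocity g t) (v t) 0 i)).
Proof.
move=> [ts [ts_path ts_last hts]] hv.
(* The induction on the break points moves the left end, hence the variable [a]; [t0] and [t1] stay
   fixed as bounds of the domain of the field. *)
suff H : forall a, path <%R a ts ->
    (forall i, (i < size ts)%N -> C1_path (nth t0 (a :: ts) i) (nth t0 ts i) g) ->
    t0 <= a -> last a ts <= t1 -> a <= last a ts /\ mu.-integrable `[a, last a ts]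
    (EFin \o (fun t => @B (g t) (velocity g t) (v t) 0 i)).
  by have [] := H t0 ts_path hts (lexx _); rewrite ts_last.
elim: ts {ts_path ts_last hts} => [a _ _ _ _ /=|b ts IH a /= /andP[ab pts] hts t0a lt1].
  split => //; rewrite set_itv1; apply/integrableP; split.
    exact: measurable_fun_set1.
  by rewrite integral_set1.
have [||bl intb] := IH b pts _ _ lt1.
- by move=> j jts; exact: (hts j.+1).
- exact: le_trans t0a (ltW ab).
split; first exact: le_trans (ltW ab) bl.
apply: integrable_itv_cat intb => //; first exact: ltW.
apply: C1_path_integrand_integrable hv => //; first exact: (hts 0%N).
exact: le_trans bl lt1.
Qed.

(** Symmetry of [g] about the midpoint reverses its velocity while [v] keeps its value, so one sign
    comes out of the first slot. *)
Lemma two_form_reflect (g : R -> X) (v : forall t, Tan (g t)) (a b t : R) :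
  {in `]a, b[, forall s, g (a + b - s) = g s} -> t \in `]a, b[ ->
  v (a + b - t) = v t :> 'rV[R]_n ->
  @B (g (a + b - t)) (velocity g (a + b - t)) (v (a + b - t)) =
  - @B (g t) (velocity g t) (v t).
Proof.
move=> gab tab vt.
have gvel : velocity g t = - velocity g (a + b - t) :> 'rV[R]_n.
  rewrite -velocity_reflect; apply: near_eq_velocity.
  have : \forall s \near t, s \in `]a, b[ by exact: near_in_itvoo.
  by apply: filterS => s /gab.
have velE : velocity g (a + b - t) = - velocity g t :> 'rV[R]_n.
  by rewrite gvel opprK.
exact: etrans (eq_two_form (gab t tab) velE vt) (two_formNl _ _).
Qed.

Lemma vintegral_backtrack (t0 t1 T d : R) (g g0 : R -> X)
    (v : forall t, Tan (g t)) (v0 : forall t, Tan (g0 t)) :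
  t0 <= T -> 0 < d -> T + 2 * d < t1 ->
  piecewise_C1 t0 t1 g -> continuous_field t0 t1 v ->
  backtracks T d (bundle_path v) ->
  {in `[t0, t1 - 2 * d],
    forall t, bundle_path v0 t = erase T d (bundle_path v) t} ->
  vintegral t0 t1 (fun t => @B (g t) (velocity g t) (v t)) =
  vintegral t0 (t1 - 2 * d) (fun t => @B (g0 t) (velocity g0 t) (v0 t)).
Proof.
move=> t0T d0 Tt1 hg hv vback v0E; apply/rowP => i; rewrite !mxE.
have Tt1' : T <= t1 by lra.
have Tt1d : T <= t1 - 2 * d by lra.
have TTd : T <= T + 2 * d by lra.
have Tdt1 : T + 2 * d <= t1 by lra.
have t0Td : t0 <= T + 2 * d by lra.
pose F t : R := @B (g t) (velocity g t) (v t) 0 i.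
pose F0 t : R := @B (g0 t) (velocity g0 t) (v0 t) 0 i.
have intF : mu.-integrable `[t0, t1] (EFin \o F).
  exact: piecewise_C1_integrand_integrable.
have intFS a b : t0 <= a -> b <= t1 -> mu.-integrable `[a, b] (EFin \o F).
  move=> t0a bt1; apply: integrableS intF => //.
  by apply: subset_itv; rewrite bnd_simp.
(* The constant is twice the midpoint [T + d] of the backtracked interval. *)
have FN : {in `]T, T + 2 * d[, forall t, F (T + (T + 2 * d) - t) = - F t}.
  have back t : t \in `]T, T + 2 * d[ -> g (T + (T + 2 * d) - t) = g t /\
      v (T + (T + 2 * d) - t) = v t :> 'rV[R]_n.
    rewrite in_itv /= => tT; apply: bundle_path_inj.
    (* [backtracks] runs over the left half only: there u = t - T, and on the right half u = T + 2 *
       d - t is the parameter of the mirror image. *)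
    have [td|dt] := leP t (T + d).
      have := vback (t - T); rewrite (_ : T + (t - T) = t); last by lra.
      by rewrite (_ : T + 2 * d - (t - T) = T + (T + 2 * d) - t);
        [move=> -> //; lra | lra].
    have := vback (T + 2 * d - t).
    rewrite (_ : T + 2 * d - (T + 2 * d - t) = t); last by lra.
    by rewrite (_ : T + (T + 2 * d - t) = T + (T + 2 * d) - t);
      [move=> -> //; lra | lra].
  move=> t tT; have gab : {in `]T, T + 2 * d[, forall s, g (T + (T + 2 * d) - s) = g s}.
    by move=> s /back[].
  have [_ vt] := back t tT.
  have := congr1 (fun M : 'rV[R]_m => M 0 i) (two_form_reflect gab tT vt).
  by rewrite mxE.
(* Open intervals are used on both sides of [T], since velocities agree only where the paths agree
   on a neighbourhood. *)
have gv0 t : t \in `]t0, T[ -> g0 t = g t /\ v0 t = v t :> 'rV[R]_n.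
  rewrite in_itv /= => tT; apply: bundle_path_inj.
  rewrite v0E /erase; last by rewrite in_itv /=; lra.
  by rewrite ifT//; lra.
have gv1 t : t \in `]T, t1 - 2 * d[ ->
    g0 t = g (t + 2 * d) /\ v0 t = v (t + 2 * d) :> 'rV[R]_n.
  rewrite in_itv /= => tT; apply: bundle_path_inj.
  rewrite v0E /erase; last by rewrite in_itv /=; lra.
  by rewrite ifF//; apply/negbTE; rewrite -ltNge; lra.
have FF0 : {in `]t0, T[, F =1 F0}.
  move=> t tT; have [gt vt] := gv0 t tT.
  have velt : velocity g0 t = velocity g t :> 'rV[R]_n.
    apply: near_eq_velocity.
    have : \forall s \near t, s \in `]t0, T[ by exact: near_in_itvoo.
    by apply: filterS => s /gv0[].
  exact: esym (congr1 (fun M : 'rV[R]_m => M 0 i) (eq_two_form gt velt vt)).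
have FF1 : {in `]T, t1 - 2 * d[, (fun t => F (t + 2 * d)) =1 F0}.
  move=> t tT; have [gt vt] := gv1 t tT.
  have velt : velocity g0 t = velocity g (t + 2 * d) :> 'rV[R]_n.
    rewrite -velocity_shift; apply: near_eq_velocity.
    have : \forall s \near t, s \in `]T, t1 - 2 * d[ by exact: near_in_itvoo.
    by apply: filterS => s /gv1[].
  exact: esym (congr1 (fun M : 'rV[R]_m => M 0 i) (eq_two_form gt velt vt)).
have intF1 : mu.-integrable `[T, t1 - 2 * d] (EFin \o (fun t => F (t + 2 * d))).
  have := integrable_shift (2 * d) (intFS _ _ t0Td (lexx t1)).
  by rewrite addrK.
(* Integrability of [F0] is inherited from [F] on each side of [T]. *)
have intF0 : mu.-integrable `[t0, t1 - 2 * d] (EFin \o F0).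
  apply: (@integrable_itv_cat _ _ _ T) => //.
    exact: (eq_integrable_oo FF0 (intFS _ _ (lexx _) Tt1')).
  exact: (eq_integrable_oo FF1 intF1).
rewrite -[LHS]/(\int[mu]_(t in `[t0, t1]) F t).
rewrite -[RHS]/(\int[mu]_(t in `[t0, t1 - 2 * d]) F0 t).
rewrite (@Rintegral_itv_cat _ _ _ T)//.
rewrite (@Rintegral_itv_cat _ _ T (T + 2 * d))//; last exact: intFS.
rewrite (Rintegral_antisym (intFS _ _ t0T Tdt1) FN) add0r.
rewrite [RHS](@Rintegral_itv_cat _ _ _ T)//.
congr (_ + _).
  exact: (eq_Rintegral_oo FF0 (intFS _ _ (lexx _) Tt1')).
rewrite -(eq_Rintegral_oo FF1)// -(@Rintegral_shift _ (2 * d)) ?addrK//.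
exact: intFS.
Qed.

End PathIntegrand.

Theorem theorem3p1 (R : realType) (nG nH nP nM : nat)
  (G : lieGroupType R nG) (H : lieGroupType R nH)
  (alpha : G -> H -> H) (tau : H -> G)
  (hGH : lie_crossed_module alpha tau)
  (P : manifoldType R nP) (M : manifoldType R nM)
  (pi : P -> M) (act : P -> G -> P)
  (hP : principal_bundle pi act)
  (Abar A : forall p : P, Tan p -> Lie G)
  (hAbar : connection act Abar) (hA : connection act A)
  (B : forall p : P, Tan p -> Tan p -> Lie H)
  (hB : smooth_two_form B)
  (hB_equivariant : alpha_equivariant act alpha B)
  (hB_vertical : vanishes_on_vertical pi B)
  (t0 t1 T delta : R)
  (hT : t0 <= T) (hdelta : T < T + 2 * delta) (ht1 : T + 2 * delta < t1)
  (gamma : R -> M)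
  (hgamma : piecewise_C1 t0 t1 gamma)
  (hgamma_back : backtracks T delta gamma)
  (gammat : R -> P)
  (hgammat : horizontal_lift pi Abar t0 t1 gamma gammat)
  (gammat0 : R -> P)
  (hgammat0 : horizontal_lift pi Abar t0 (t1 - 2 * delta)
                (erase T delta gamma) gammat0)
  (hinit : gammat0 t0 = gammat t0)
  (v : forall t, Tan (gammat t))
  (hv : continuous_field t0 t1 v)
  (hv_back : backtracks T delta (bundle_path v))
  (v0 : forall t, Tan (gammat0 t))
  (hv0 : forall t, t \in `[t0, t1 - 2 * delta] ->
            bundle_path v0 t = erase T delta (bundle_path v) t) :
  omega tau A B t0 t1 v = omega tau A B t0 (t1 - 2 * delta) v0 /\
  (omega tau A B t0 t1 v = 0 <-> omega tau A B t0 (t1 - 2 * delta) v0 = 0).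

Proof.
have d0 : 0 < delta by lra.
suff -> : omega tau A B t0 t1 v = omega tau A B t0 (t1 - 2 * delta) v0 by [].
have [[hg _] _] := hgammat.
rewrite /omega (@vintegral_backtrack _ _ _ _ _ hB t0 t1 T delta _ _ _ v0)//.
congr (_ + _).
(* As [t0 <= T], [erase] takes its first branch at [t0], so both initial terms are the same. *)
have [-> ->//] : gammat t0 = gammat0 t0 /\ v t0 = v0 t0 :> 'rV[R]_nP.
apply: bundle_path_inj; rewrite hv0 /erase ?hT//.
by rewrite in_itv /=; lra.
Qed.
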